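(* Let $n,k,s\geq 2$ be integers with $n\geq sk+1$. Then the $s$-stable Kneser graph $KG(n,k)_{s\text{-stab}}$ is vertex transitive if and only if $n=sk+1$.
   Context: Let $[n]=\{1,\dots,n\}$. A subset $S\subseteq[n]$ is $s$-stable if for all distinct $i,j\in S$ we have $s\leq |i-j|\leq n-s$. $[n]^k_s$ denotes the family of $s$-stable $k$-element subsets of $[n]$. The $s$-stable Kneser graph $KG(n,k)_{s\text{-stab}}$ has vertex set $[n]^k_s$, two vertices being adjacent iff the corresponding $k$-subsets are disjoint. *)

(* Defs.v *)
From mathcomp Require Import all_boot all_order all_fingroup all_algebra.

Set Implicit Arguments.
Unset Strict Implicit.
Unset Printing Implicit Defensive.

(* [n] = {1, ..., n} is encoded as 'I_n = {0, ..., n - 1}; the shift by one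
   does not affect the differences |i - j|. *)

Definition stable (n s : nat) (S : {set 'I_n}) : bool :=
  [forall i in S, forall j in S,
     (i != j) ==> (s <= absz (Posz i - Posz j)%R <= n - s)].

Definition stable_ksets (n k s : nat) : {set {set 'I_n}} :=
  [set S : {set 'I_n} | (#|S| == k) && stable s S].

Notation stable_Kneser_vertex n k s :=
  {S : {set 'I_n} | S \in stable_ksets n k s}.

Definition stable_Kneser (n k s : nat) : rel (stable_Kneser_vertex n k s) :=
  fun A B => [disjoint val A & val B].

Definition graph_automorphism (V : finType) (e : rel V) (f : {perm V}) : Prop :=
  forall x y : V, e (f x) (f y) = e x y.

Definition vertex_transitive (V : finType) (e : rel V) : Prop :=
  forall x y : V, exists2 f : {perm V}, graph_automorphism e f & f x = y.

(* Main.v *)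
Require Import Defs.
From mathcomp Require Import all_boot all_order all_fingroup all_algebra.
From mathcomp Require Import zify.

(* If n = sk + 1, every stable k-set has one cyclic gap s + 1 and all other
   gaps s, so the rotations act transitively on the vertices.

   If n >= sk + 2, the relation |A :&: B| = k - 1 can be read off the graph:
   among the vertices B <> A not adjacent to A, it singles out those for which
   N(A) :&: N(B) is maximal for inclusion.  This rests on two facts: a stable
   k-set B that meets A always yields some x in B with A - a + x stable, and
   every point outside A + x then lies in a stable k-set disjoint from A + x.
   So an automorphism preserves single-element exchanges, and also whether the
   union of the two exchanged sets is stable.  In {0, s, ..., (k-1)s} the
   exchange (k-1)s -> n - s shares no induced 4-cycle of the exchange graph
   with any exchange b -> y such that A + y is not stable, whereas every
   exchange of {0, s, ..., (k-2)s, (k-1)s + 1} lies in such a 4-cycle. *)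

Set Implicit Arguments.
Unset Strict Implicit.
Unset Printing Implicit Defensive.

(** * Cyclic distance, rotations and stable sets *)

(* The cyclic distance of [i] and [j] modulo [n] is at least [s]. *)
Definition far (n s i j : nat) : bool :=
  (i + s <= j) && (j + s <= i + n) || (j + s <= i) && (i + s <= j + n).

Definition rot_ord (n t : nat) (i : 'I_n) : 'I_n :=
  Ordinal (ltn_pmod (i + t) (leq_ltn_trans (leq0n i) (ltn_ord i))).

Lemma rot_ord_cases n t (i : 'I_n) : t <= n ->
  (rot_ord t i = i + t :> nat) \/ (rot_ord t i + n = i + t).
Proof.
move=> tn; have ltin := ltn_ord i; rewrite /=.
case: (ltnP (i + t) n) => h; first by left; rewrite modn_small.
by right; rewrite -(subnK h) modnDr modn_small; lia.
Qed.

Lemma far_rot_ord n s t (i j : 'I_n) : t <= n ->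
  far n s (rot_ord t i) (rot_ord t j) = far n s i j.
Proof.
move=> tn; have := rot_ord_cases i tn; have := rot_ord_cases j tn.
have := ltn_ord i; have := ltn_ord j.
have := ltn_ord (rot_ord t i); have := ltn_ord (rot_ord t j).
move: (rot_ord t i : nat) (rot_ord t j : nat) => u v; rewrite /far.
lia.
Qed.

Lemma stableP n s (S : {set 'I_n}) :
  reflect {in S &, forall i j : 'I_n, i != j -> far n s i j} (stable s S).
Proof.
have E (i j : 'I_n) : i != j ->
    far n s i j = (s <= absz (Posz i - Posz j)%R <= n - s).
  move=> /negPf; rewrite -val_eqE /= /far => ne.
  by have := ltn_ord i; have := ltn_ord j; lia.
apply: (iffP 'forall_implyP) => [h i j Si Sj ne | h i Si].
  by have /'forall_implyP/(_ j Sj)/implyP/(_ ne) := h i Si; rewrite E.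
by apply/'forall_implyP => j Sj; apply/implyP => ne; rewrite -E // h.
Qed.

Lemma stable_ksetsP n k s (S : {set 'I_n}) :
  reflect (#|S| = k /\ {in S &, forall i j : 'I_n, i != j -> far n s i j})
          (S \in stable_ksets n k s).
Proof.
rewrite inE; apply: (iffP andP) => [[/eqP cS /stableP] | [/eqP cS /stableP]];
  by split.
Qed.

Lemma imset_stable_ksets n k s (f : 'I_n -> 'I_n) (A : {set 'I_n}) : 0 < s ->
  A \in stable_ksets n k s ->
  {in A &, forall i j : 'I_n, i != j -> far n s (f i) (f j)} ->
  f @: A \in stable_ksets n k s.
Proof.
move=> s0 /stable_ksetsP[cA _] hf; apply/stable_ksetsP; split.
  (* Injectivity of [f] on [A] comes for free: as [0 < s], no point is far from itself. *)
  rewrite card_in_imset // => i j Ai Aj fij; apply/eqP/negPn/negP => /(hf _ _ Ai Aj).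
  by rewrite fij /far; lia.
move=> _ _ /imsetP[i Ai ->] /imsetP[j Aj ->] ne; apply: hf => //.
by apply: contraNneq ne => ->.
Qed.

(** * Exchanging one element of a stable set *)

Lemma card_swap (T : finType) (A : {set T}) a x :
  a \in A -> x \notin A -> #|x |: (A :\ a)| = #|A|.
Proof.
by move=> Aa Ax; rewrite cardsU1 !inE (negPf Ax) andbF (cardsD1 a A) Aa.
Qed.

Lemma swap_stable_ksets n k s (A : {set 'I_n}) a x :
  A \in stable_ksets n k s -> a \in A -> x \notin A ->
  {in A, forall y : 'I_n, y != a -> far n s x y} ->
  x |: (A :\ a) \in stable_ksets n k s.
Proof.
move=> /stable_ksetsP[cA sA] Aa Ax h; apply/stable_ksetsP.
split; first by rewrite card_swap.
have farC i j : far n s i j = far n s j i by rewrite /far orbC.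
move=> i j /setU1P[->|/setD1P[ia Ai]] /setU1P[->|/setD1P[ja Aj]] ne.
- by rewrite eqxx in ne.
- exact: h.
- by rewrite farC h.
- exact: sA.
Qed.

(* [C] is a rotation of [A] by less than [s], corrected at the single point
   where it could hit [x]; if [c] is far from [A], all of [A] but the
   predecessor of [c] is rotated by one. *)
Lemma avoiding_stable_kset n k s (A : {set 'I_n}) a x c : 1 < s -> 1 < k ->
  A \in stable_ksets n k s -> a \in A -> x \notin A ->
  x |: (A :\ a) \in stable_ksets n k s -> c \notin A -> c != x ->
  exists2 C, C \in stable_ksets n k s & c \in C /\ [disjoint C & x |: A].
Proof.
move=> s1 k1 AK Aa Ax /stable_ksetsP[_ xK] Ac cx.
have /stable_ksetsP[cA sA] := AK.
have xfar y : y \in A -> y != a -> far n s x y.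
  move=> Ay ya; apply: xK; rewrite ?setU11 // ?inE ?ya ?Ay ?orbT //.
  by apply: contraNneq Ax => ->.
have nA y : y \in A -> y <> c :> nat.
  by move=> Ay /val_inj E; rewrite -E Ay in Ac.
have nx y : y \in A -> y <> x :> nat.
  by move=> Ay /val_inj E; rewrite -E Ay in Ax.
have cxn : c <> x :> nat by move=> /val_inj E; rewrite E eqxx in cx.
have sA' y z : y \in A -> z \in A -> y = z \/ (y <> z :> nat /\ far n s y z).
  move=> Ay Az; case: (eqVneq y z) => [->|ne]; [by left | right; split].
    by move=> /val_inj E; rewrite E eqxx in ne.
  exact: sA.
have xfar' y : y \in A -> y = a \/ (y <> a :> nat /\ far n s x y).
  move=> Ay; case: (eqVneq y a) => [->|ne]; [by left | right; split].
    by move=> /val_inj E; rewrite E eqxx in ne.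
  exact: xfar.
have n2s : 2 * s <= n.
  have : 1 < #|A| by rewrite cA.
  case/card_gt1P=> y [z [Ay Az yz]]; have := sA _ _ Ay Az yz.
  by rewrite /far; lia.
have build (f : 'I_n -> 'I_n) b : b \in A -> f b = c ->
    {in A &, forall i j : 'I_n, i != j -> far n s (f i) (f j)} ->
    (forall y, y \in A -> f y <> x) ->
    (forall y z, y \in A -> z \in A -> f y <> z) ->
    exists2 C, C \in stable_ksets n k s & c \in C /\ [disjoint C & x |: A].
  move=> Ab fb ff fx fA; exists (f @: A); first by apply: imset_stable_ksets => //; lia.
  split; first by rewrite -fb imset_f.
  rewrite disjoint_subset; apply/subsetP => _ /imsetP[y Ay ->].
  rewrite !inE negb_or; apply/andP; split; first by apply/eqP; apply: fx.
  by apply/negP => Ay'; apply: (fA y _ Ay Ay').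
have ltx := ltn_ord x; have ltc := ltn_ord c; have lta := ltn_ord a.
(* Here [c] is less than [s] steps from [b]: rotating by [t] carries [b] to [c], and [u] goes one
   step further in the same direction. Only [a] can be rotated onto [x], since the other points of
   [A] are far from [x]. The next point of the image is then at least [s + 1] past [x], which leaves
   room for the extra step. *)
have near t u b : b \in A -> rot_ord t b = c ->
    (0 < t < s /\ u = t.+1) \/ (0 < n - t < s /\ u = t.-1) -> t <= n ->
    exists2 C, C \in stable_ksets n k s & c \in C /\ [disjoint C & x |: A].
  move=> Ab bc tu tn; have un : u <= n by lia.
  have := rot_ord_cases b tn; rewrite bc => Eb.
  pose f y := if rot_ord t y == x then rot_ord u y else rot_ord t y.
  have ltb := ltn_ord b.
  have fE y : y \in A -> (f y = rot_ord t y /\ rot_ord t y <> x :> nat) \/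
       [/\ f y = rot_ord u y, rot_ord t y = x & y = a].
    move=> Ay; rewrite /f; case: eqP => [E | E]; last by left; split => // /val_inj.
    right; split => //; case: (xfar' y Ay) => // -[ya].
    have := rot_ord_cases y tn; rewrite E /far; have := ltn_ord y; lia.
  apply: (build f b) => //.
  - by rewrite /f bc (negPf cx).
  - move=> i j Ai Aj ij; have fij := sA _ _ Ai Aj ij.
    have lti := ltn_ord i; have ltj := ltn_ord j.
    case: (fE i Ai) => [[-> Ei]|[-> Ei ia]]; case: (fE j Aj) => [[-> Ej]|[-> Ej ja]].
    + by rewrite far_rot_ord.
    + have := rot_ord_cases i tn; have := rot_ord_cases j un; have := rot_ord_cases j tn.
      have := ltn_ord (rot_ord t i); have := ltn_ord (rot_ord u j).
      have ia : i != a by rewrite -ja.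
      have := xfar _ Ai ia; rewrite -Ej; have := ltn_ord (rot_ord t j).
      move: fij tu n2s s1 lti ltj tn; rewrite /far.
      by move: (rot_ord t i : nat) (rot_ord t j : nat) (rot_ord u j : nat); clear; lia.
    + have := rot_ord_cases j tn; have := rot_ord_cases i un; have := rot_ord_cases i tn.
      have := ltn_ord (rot_ord t j); have := ltn_ord (rot_ord u i).
      have ja : j != a by rewrite -ia eq_sym.
      have := xfar _ Aj ja; rewrite -Ei; have := ltn_ord (rot_ord t i).
      move: fij tu n2s s1 lti ltj tn; rewrite /far.
      by move: (rot_ord t j : nat) (rot_ord t i : nat) (rot_ord u i : nat); clear; lia.
    + by rewrite ia ja eqxx in ij.
  - move=> y Ay; case: (fE y Ay) => [[-> Ei]|[-> Ei ia]]; first by move=> E; apply: Ei; rewrite E.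
    move=> E; have := rot_ord_cases y un; have := rot_ord_cases y tn; rewrite E Ei.
    have := ltn_ord y; lia.
  - move=> y z Ay Az fyz; have lty := ltn_ord y; have ltz := ltn_ord z.
    case: (fE y Ay) => [[]|[]]; rewrite fyz => E.
      have := rot_ord_cases y tn; rewrite -E.
      by case: (sA' _ _ Ay Az) => [->|[]]; rewrite /far; lia.
    have := rot_ord_cases y un; rewrite -E => h1 E2.
    have := rot_ord_cases y tn; rewrite E2 => h2 ya; subst y.
    by case: (xfar' z Az) => [E3|[]]; [rewrite E3 in h1|rewrite /far]; lia.
have [/existsP[b /andP[Ab nb]]|/existsPn noclose] := boolP [exists b in A, ~~ far n s b c].
  have ltb := ltn_ord b; have bc := nA _ Ab.
  have [E1|E1] : (exists2 t, 0 < t < s & (b + t = c \/ b + t = c + n)) \/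
         (exists2 t, 0 < t < s & (c + t = b \/ c + t = b + n)).
  - rewrite /far in nb.
    case: (ltngtP b c) => h; last by lia.
      case: (leqP (b + s) c) => h2; last by left; exists (c - b); lia.
      by right; exists (b + n - c); lia.
    case: (leqP (c + s) b) => h2; last by right; exists (b - c); lia.
    by left; exists (c + n - b); lia.
  - case: E1 => t ht Et; apply: (near t t.+1 b) => //; try lia.
    apply: val_inj; have tn : t <= n by lia.
    have := rot_ord_cases b tn; have := ltn_ord (rot_ord t b).
    by move: (rot_ord t b) => /= [m hm] /=; lia.
  - case: E1 => t ht Et; apply: (near (n - t) (n - t).-1 b) => //; try lia.
    apply: val_inj; have tn : n - t <= n by lia.
    have := rot_ord_cases b tn; have := ltn_ord (rot_ord (n - t) b).
    by move: (rot_ord _ b) => /= [m hm] /=; lia.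
have cfar y : y \in A -> far n s y c.
  by move=> Ay; have := noclose y; rewrite Ay /= negbK.
(* [d y] counts the steps from [y] forward to [c], so its minimiser [b] is the last point of [A]
   before [c]. In [f] below, [b] jumps to [c], and every other point moves one step forward, or two
   if one step would land on [x]. *)
pose d (y : 'I_n) := if y <= c then c - y else c + n - y.
have [b Ab bmin] : exists2 b, b \in A & forall y, y \in A -> d b <= d y.
  by case: (arg_minnP d Aa) => b Ab h; exists b.
have n1 : 1 <= n by lia.
have n2 : 2 <= n by lia.
pose f y := if y == b then c else if rot_ord 1 y == x then rot_ord 2 y else rot_ord 1 y.
have ltb := ltn_ord b.
have fE y : y \in A -> [\/ f y = c /\ y = b,
     [/\ f y = rot_ord 1 y, rot_ord 1 y <> x :> nat & y <> b :> nat] |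
     [/\ f y = rot_ord 2 y, rot_ord 1 y = x, y <> b :> nat & y = a]].
  move=> Ay; rewrite /f; case: (eqVneq y b) => yb; first by constructor 1.
  have yb' : y <> b :> nat by move/val_inj => E; rewrite E eqxx in yb.
  case: eqP => [E | E]; last by constructor 2; split => // /val_inj.
  constructor 3; split => //; case: (xfar' y Ay) => // -[ya].
  have := rot_ord_cases y n1; rewrite E /far; have := ltn_ord y; lia.
have cfb := cfar b Ab.
(* Since [b] lies between [y] and [c], there are at least [2 * s] steps from [y] forward to [c].
   Moving [y] by at most two steps keeps it far from [c], because [2 * s - 2 >= s]. *)
have fary y : y \in A -> y <> b :> nat ->
    (y + 2 * s <= c /\ c + s <= y + n) \/ (c + s <= y /\ y + 2 * s <= c + n).
  move=> Ay yb; have lty := ltn_ord y; have := bmin y Ay; have := cfar y Ay.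
  have : far n s y b by case: (sA' _ _ Ay Ab) => [E|[]] //; rewrite E in yb.
  by move: cfb; rewrite /d /far; case: (leqP b c); case: (leqP y c); lia.
apply: (build f b) => //.
- by rewrite /f eqxx.
- have H i j : i \in A -> j \in A -> i <> j :> nat -> far n s i j ->
      j <> b :> nat -> far n s (f i) (f j).
    move=> Ai Aj ij fij jb.
    have lti := ltn_ord i; have ltj := ltn_ord j.
    have fj := fary _ Aj jb.
    have := rot_ord_cases j n1; have := rot_ord_cases j n2.
    have := ltn_ord (rot_ord 1 j); have := ltn_ord (rot_ord 2 j).
    have := rot_ord_cases i n1; have := rot_ord_cases i n2.
    have := ltn_ord (rot_ord 1 i); have := ltn_ord (rot_ord 2 i).
    case: (fE j Aj) => [[_ E]|[-> Ej _]|[-> Ej _ ja]]; first by rewrite E in jb.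
      case: (fE i Ai) => [[-> Ei]|[-> _ _]|[-> Ei _ ia]].
      + move: (rot_ord 1 i : nat) (rot_ord 1 j : nat) (rot_ord 2 i : nat)
          (rot_ord 2 j : nat) => ????.
        by move: n2s fj s1 lti ltj ltc; rewrite /far; clear; lia.
      + by rewrite far_rot_ord.
      + have := xfar' _ Aj; rewrite -Ei -ia => -[E|[]]; first by rewrite E in ij.
        move: fij; rewrite /far.
        move: (rot_ord 1 i : nat) (rot_ord 1 j : nat) (rot_ord 2 i : nat)
          (rot_ord 2 j : nat) => ????.
        by move: n2s s1 lti ltj; clear; lia.
    case: (fE i Ai) => [[-> Ei]|[-> Ei _]|[_ _ _ ia]]; last by rewrite ia ja in ij.
    + move: (rot_ord 1 i : nat) (rot_ord 1 j : nat) (rot_ord 2 i : nat)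
          (rot_ord 2 j : nat) => ????.
      by move: n2s fj s1 lti ltj ltc; rewrite /far; clear; lia.
    + have := xfar' _ Ai; rewrite -Ej -ja => -[E|[]]; first by rewrite E in ij.
      move: fij; rewrite /far.
      move: (rot_ord 1 i : nat) (rot_ord 1 j : nat) (rot_ord 2 i : nat)
          (rot_ord 2 j : nat) => ????.
      by move: n2s s1 lti ltj; clear; lia.
  have farC i j : far n s i j = far n s j i by rewrite /far orbC.
  move=> i j Ai Aj ij; have fij := sA _ _ Ai Aj ij.
  have ij' : i <> j :> nat by move/val_inj => E; rewrite E eqxx in ij.
  case: (eqVneq (j : nat) b) => [jb|/eqP jb]; last exact: H.
  rewrite farC; apply: H => //; [by move=> E; apply: ij'|by rewrite farC|].
  by move=> ib; apply: ij'; rewrite ib jb.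
- move=> y Ay; case: (fE y Ay) => [[-> _]|[-> Ei _]|[-> Ei _ ia]].
  + by move/(congr1 val).
  + by move=> E; apply: Ei; rewrite E.
  + move=> E; have := rot_ord_cases y n2; have := rot_ord_cases y n1; rewrite E Ei.
    have := ltn_ord y; lia.
- move=> y z Ay Az fyz; have lty := ltn_ord y; have ltz := ltn_ord z.
  case: (fE y Ay) => [[]|[]|[]]; rewrite fyz => E.
  + by rewrite E in Az; rewrite Az in Ac.
  + have := rot_ord_cases y n1; rewrite -E.
    by case: (sA' _ _ Ay Az) => [->|[]]; rewrite /far; lia.
  have := rot_ord_cases y n2; rewrite -E => h1 E2.
  have := rot_ord_cases y n1; rewrite E2 => h2 _ ya; subst y.
  by case: (xfar' z Az) => [E3|[]]; [rewrite E3 in h1|rewrite /far]; lia.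
Qed.

Lemma rot_ord_inj n t : t <= n -> injective (@rot_ord n t).
Proof.
move=> tn i j E; apply: val_inj => /=.
have := rot_ord_cases i tn; rewrite E; have := rot_ord_cases j tn.
have := ltn_ord i; have := ltn_ord j; move: (rot_ord t j : nat); clear; lia.
Qed.

Lemma rot_ordD n t u (i : 'I_n) : rot_ord t (rot_ord u i) = rot_ord (u + t) i.
Proof. by apply: val_inj; rewrite /= modnDml addnA. Qed.

(* If no [x] in [B] could be exchanged, the predecessor map would send [B - A]
   bijectively to [A - B], so [A - B] would be closed under cyclic successor in
   [A]; its element closest to a common point [z] rules this out. *)
Lemma exists_swap n k s (A B : {set 'I_n}) : 1 < s ->
  A \in stable_ksets n k s -> B \in stable_ksets n k s -> A != B ->
  ~~ [disjoint A & B] ->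
  exists2 x, x \in B :\: A &
    exists2 a, a \in A & x |: (A :\ a) \in stable_ksets n k s.
Proof.
move=> s1 AK BK AB /pred0Pn[z /andP[/= Az Bz]].
have /stable_ksetsP[cA sA] := AK; have /stable_ksetsP[cB sB] := BK.
have [/existsP[x /andP[Dx /existsP[a /andP[Aa H]]]]|/existsPn noswap] :=
  boolP [exists x in B :\: A, [exists a in A, x |: (A :\ a) \in stable_ksets n k s]].
  by exists x => //; exists a.
have sA' y w : y \in A -> w \in A -> y <> w :> nat -> far n s y w.
  by move=> Ay Aw ne; apply: sA => //; apply/eqP => E; rewrite E in ne.
have sB' y w : y \in B -> w \in B -> y <> w :> nat -> far n s y w.
  by move=> Ay Aw ne; apply: sB => //; apply/eqP => E; rewrite E in ne.
pose before (a x : 'I_n) := (a < x < a + s) || (x + n < a + s).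
have nearE x : x \in B :\: A -> exists a a' : 'I_n,
    [/\ a \in A, a' \in A, before a x & before x a'].
  case/setDP=> Bx Ax.
  have other a : a \in A -> exists y : 'I_n, [/\ y \in A, y != a & ~~ far n s x y].
    move=> Aa; have := noswap x; rewrite inE Bx Ax /= => /existsPn/(_ a).
    rewrite Aa /= => H.
    have [/existsP[y /andP[Ay /andP[ya fy]]]|/existsPn E] :=
      boolP [exists y in A, (y != a) && ~~ far n s x y].
      by exists y; split.
    case/negP: H; apply: swap_stable_ksets => // y Ay ya.
    by have := E y; rewrite Ay ya /= negbK.
  (* Using [other] twice gives two distinct points of [A] near [x]; being far from each other, they
     lie on opposite sides of [x]. *)
  have [y1 [Ay1 _ f1]] := other z Az.
  have [y2 [Ay2 ne f2]] := other y1 Ay1.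
  have n1 : y1 <> x :> nat by move/val_inj=> E; rewrite -E Ay1 in Ax.
  have n2 : y2 <> x :> nat by move/val_inj=> E; rewrite -E Ay2 in Ax.
  have f12 := sA _ _ Ay2 Ay1 ne.
  have lx := ltn_ord x; have l1 := ltn_ord y1; have l2 := ltn_ord y2.
  have [E|E] : (before y1 x /\ before x y2) \/ (before y2 x /\ before x y1).
    by move: f12 f1 f2 n1 n2 lx l1 l2 s1; rewrite /before /far; clear; lia.
  - by exists y1, y2; case: E; split.
  - by exists y2, y1; case: E; split.
have beforeB a x : a \in A -> x \in B :\: A -> before a x || before x a -> a \in A :\: B.
  move=> Aa /setDP[Bx Ax] bax; rewrite inE Aa andbT; apply/negP => Ba.
  have ax : a <> x :> nat by move/val_inj=> E; rewrite -E Aa in Ax.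
  have := sB' _ _ Ba Bx ax; have lx := ltn_ord x; have la := ltn_ord a.
  by move: ax bax lx la; rewrite /before /far; clear; lia.
(* The default value [x] is never taken on [B :\: A], by [pP]. *)
pose p x := odflt x [pick a in A | before a x].
have pP x : x \in B :\: A -> p x \in A /\ before (p x) x.
  move=> Dx; rewrite /p; case: pickP => [a /andP[] // | E].
  by have [a [a' [Aa _ ax _]]] := nearE x Dx; have := E a; rewrite Aa ax.
have pinj : {in B :\: A &, injective p}.
  move=> x y Dx Dy pxy; have [_] := pP x Dx; have [_] := pP y Dy; rewrite pxy.
  case/setDP: Dx => Bx _; case/setDP: Dy => By _.
  move=> h1 h2; apply/eqP/negPn/negP => /(sB _ _ Bx By).
  have lx := ltn_ord x; have ly := ltn_ord y; have lp := ltn_ord (p y).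
  move: h1 h2 lx ly lp; rewrite /before /far; clear; move: (p y : nat); lia.
have imp : p @: (B :\: A) = A :\: B.
  apply/eqP; rewrite eqEcard; apply/andP; split.
    apply/subsetP => _ /imsetP[x Dx ->]; have [pA px] := pP x Dx.
    by apply: (beforeB _ x) => //; rewrite px.
  by rewrite card_in_imset // !cardsD cA cB setIC.
have [a0 D0] : exists a0, a0 \in A :\: B.
  apply/set0Pn; apply: contra AB; rewrite setD_eq0 => AsB.
  by rewrite eqEcard AsB cA cB leqnn.
(* [d y] counts the steps from [y] forward to the common point [z]. From the minimiser [a = p x] one
   meets [x] and then [a'], each in fewer than [s] steps. As [z] is far from [x], it cannot lie in
   between, so [a'] is strictly closer to [z]. *)
pose d (y : 'I_n) := if y <= z then z - y else z + n - y.
have [a Da amin] : exists2 a, a \in A :\: B & forall y, y \in A :\: B -> d a <= d y.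
  by case: (arg_minnP d D0) => a; exists a.
have : a \in p @: (B :\: A) by rewrite imp.
case/imsetP=> x Dx ax; have [_] := pP x Dx; rewrite -ax => bax.
have [_ [a' [_ Aa' _ bxa']]] := nearE x Dx.
have Da' : a' \in A :\: B by apply: (beforeB _ x) => //; rewrite bxa' orbT.
have := amin a' Da'.
have za : a <> z :> nat by move/val_inj => E; move: Da; rewrite E inE Bz.
have za' : a' <> z :> nat by move/val_inj => E; move: Da'; rewrite E inE Bz.
have Aa : a \in A by case/setDP: Da.
have Bx : x \in B by case/setDP: Dx.
have zx : x <> z :> nat by move/val_inj => E; move: Dx; rewrite E inE Az.
have f1 := sA' _ _ Aa Az za; have f2 := sA' _ _ Aa' Az za'; have f3 := sB' _ _ Bx Bz zx.
have l1 := ltn_ord a; have l2 := ltn_ord a'; have l3 := ltn_ord x; have l4 := ltn_ord z.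
move: f1 f2 f3 l1 l2 l3 l4 bax bxa' za za' zx s1; rewrite /d /before /far; clear.
by case: (leqP a z); case: (leqP a' z); lia.
Qed.

(** * Recovering the exchange graph from the Kneser graph *)

(** The graph-theoretic substitute for [C] being contained in the union of [A] and [B];
    [exchange_nbhd_sub] shows that it is faithful when [A] and [B] differ by one exchange. *)
Definition nbhd_sub (V : finType) (e : rel V) (A B C : V) : Prop :=
  forall Z, e A Z -> e B Z -> e C Z.

Lemma nbhd_sub_aut (V : finType) (e : rel V) (f : {perm V}) A B C :
  graph_automorphism e f ->
  nbhd_sub e (f A) (f B) (f C) <-> nbhd_sub e A B C.
Proof.
move=> fe; split => h Z.
  by rewrite -(fe A) -(fe B) -(fe C); apply: h.
by rewrite -(permKV f Z) !fe; apply: h.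
Qed.

Section ExchangeGraph.

Variables n k s : nat.
Hypotheses (s1 : 1 < s) (k1 : 1 < k).
Local Notation V := (stable_Kneser_vertex n k s).
Local Notation KG := (@stable_Kneser n k s).

Definition exchange_adj (A B : V) : bool :=
  (A != B) && (#|val A :&: val B| == k.-1).

Lemma card_vertex (A : V) : #|val A| = k.
Proof. by have /stable_ksetsP[] := valP A. Qed.

Lemma vertex_far (A : V) (i j : 'I_n) : i \in val A -> j \in val A -> i <> j :> nat ->
  far n s i j.
Proof.
have /stable_ksetsP[_ h] := valP A => Ai Aj ij; apply: h => //.
by apply/eqP => E; rewrite E in ij.
Qed.

Lemma sub_vertex_eq (A B : V) : val A \subset val B -> A = B.
Proof. by move=> h; apply/val_inj/eqP; rewrite eqEcard h !card_vertex leqnn. Qed.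

Lemma exchange_adjP (A B : V) : reflect
  (exists a x, [/\ a \in val A, x \notin val A & val B = x |: (val A :\ a)])
  (exchange_adj A B).
Proof.
apply: (iffP andP) => [[ne /eqP cI] | [a [x [Aa Ax E]]]].
  have cD (X Y : V) : #|val X :&: val Y| = k.-1 -> exists x, val X :\: val Y = [set x].
    by move=> cXY; apply/cards1P; rewrite cardsD card_vertex cXY; apply/eqP; lia.
  have [a Ea] := cD A B cI; have [x Ex] : exists x, val B :\: val A = [set x].
    by apply: cD; rewrite setIC.
  exists a, x; have : a \in val A :\: val B by rewrite Ea set11.
  have : x \in val B :\: val A by rewrite Ex set11.
  rewrite !inE => /andP[Ax Bx] /andP[Ba Aa]; split => //.
  have -> : val A :\ a = val B :&: val A by rewrite -Ea setDDr setDv set0U setIC.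
  by rewrite -Ex setUC setID.
split.
  by apply: contraNneq Ax => ->; rewrite E setU11.
have -> : val A :&: val B = val A :\ a.
  apply/setP => y; rewrite E !inE; case: (eqVneq y x) => [->|]; first by rewrite (negPf Ax) andbF.
  by case: (y \in val A); rewrite ?andbF ?andbT.
by have := cardsD1 a (val A); rewrite Aa card_vertex; lia.
Qed.

(** If [C] had a point [c] outside [A + x], then [avoiding_stable_kset] would provide a stable set
    through [c] that is disjoint from [A] and [B] but meets [C]. *)
Lemma exchange_nbhd_sub (A B C : V) : exchange_adj A B ->
  nbhd_sub KG A B C <-> val C \subset val A :|: val B.
Proof.
case/exchange_adjP=> a [x [Aa Ax EB]]; split => [h | sC Z]; last first.
  rewrite /stable_Kneser => dA dB; apply: disjointWl sC _.
  by rewrite -setI_eq0 setIUl setU_eq0 !setI_eq0; apply/andP.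
apply/subsetP => c Cc; apply/negPn/negP; rewrite inE negb_or => /andP[Ac Bc].
have cx : c != x by apply: contraNneq Bc => ->; rewrite EB setU11.
have BK : x |: (val A :\ a) \in stable_ksets n k s by rewrite -EB (valP B).
have [Z ZK [Zc]] := avoiding_stable_kset s1 k1 (valP A) Aa Ax BK Ac cx.
rewrite disjoint_sym => dZ.
have dA : KG A (Sub Z ZK) by apply: disjointWl dZ; rewrite subsetUr.
have dB : KG B (Sub Z ZK).
  by apply: disjointWl dZ; rewrite /= EB setUS // subD1set.
have := h _ dA dB; rewrite /stable_Kneser /= => /pred0P/(_ c) /=.
by rewrite Cc Zc.
Qed.

(** For the direct implication, a vertex [C <> A] inside [A + x] must contain [x], so [A :|: C]
    already covers [B]. For the converse, maximality is tested on the [C = A - a + x] given by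
    [exists_swap]: it lies in [A :|: B], so [B] is forced inside [A + x]. *)
Lemma exchange_adj_nbhd (A B : V) : exchange_adj A B <->
  [/\ A <> B, ~~ KG A B & forall C, C <> A -> ~~ KG A C ->
       nbhd_sub KG A B C -> nbhd_sub KG A C B].
Proof.
split=> [AB | [/eqP ne nAB mx]].
  have [/eqP ne cI] := andP AB; split=> // [|C CA _].
    by rewrite /stable_Kneser -setI_eq0 -cards_eq0 (eqP cI); lia.
  rewrite (exchange_nbhd_sub _ AB) => CAB.
  have /exchange_adjP [a [x [Aa Ax EB]]] := AB.
  have AUB : val A :|: val B = x |: val A.
    by have /setUidPl E := subD1set (val A) a; rewrite EB setUCA E.
  have Cx : x \in val C.
    apply/negPn/negP => Cx; apply: CA; apply: sub_vertex_eq; apply/subsetP => y Cy.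
    have := subsetP CAB _ Cy; rewrite AUB => /setU1P[E|//].
    by rewrite -E Cy in Cx.
  move=> Z dA dC; rewrite /stable_Kneser EB.
  have dAC : [disjoint val A :|: val C & val Z].
    by rewrite -setI_eq0 setIUl setU_eq0 !setI_eq0; apply/andP.
  apply: disjointWl dAC; apply/subsetP => y /setU1P[->|/setD1P[_ Ay]].
    by rewrite inE Cx orbT.
  by rewrite inE Ay.
have [x /setDP[Bx Ax] [a Aa SK]] := exists_swap s1 (valP A) (valP B) ne nAB.
have [C EC] : exists C : V, val C = x |: (val A :\ a) by exists (Sub (x |: (val A :\ a)) SK).
have AC : exchange_adj A C by apply/exchange_adjP; exists a, x.
have CsAB : val C \subset val A :|: val B.
  by rewrite EC; apply/subsetP => y /setU1P[->|/setD1P[_ Ay]]; rewrite inE ?Bx ?Ay ?orbT.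
have [nAC cAC] := andP AC.
have : nbhd_sub KG A C B.
  apply: mx.
  - by move=> E; rewrite E eqxx in nAC.
  - by rewrite /stable_Kneser -setI_eq0 -cards_eq0 (eqP cAC); move: k1; clear; lia.
  - move=> Z dA dB; rewrite /stable_Kneser; apply: disjointWl CsAB _.
    by rewrite -setI_eq0 setIUl setU_eq0 !setI_eq0; apply/andP.
rewrite (exchange_nbhd_sub _ AC) => BsAC.
have AUC : val A :|: val C = x |: val A.
  by have /setUidPl E := subD1set (val A) a; rewrite EC setUCA E.
have [b Ab Bb] : exists2 b, b \in val A & b \notin val B.
  by apply/subsetPn; apply: contra ne => /sub_vertex_eq ->.
apply/exchange_adjP; exists b, x; split => //; apply/eqP.
rewrite eqEcard card_swap // !card_vertex leqnn andbT; apply/subsetP => y By.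
have := subsetP BsAC _ By; rewrite AUC !inE => /orP[->|->] //; rewrite andbT.
by rewrite (contraNneq _ Bb) ?orbT // => <-.
Qed.

Lemma exchange_adj_aut (f : {perm V}) : graph_automorphism KG f ->
  forall A B, exchange_adj (f A) (f B) = exchange_adj A B.
Proof.
move=> fe A B; apply/idP/idP => /exchange_adj_nbhd[ne nAB mx];
  apply/exchange_adj_nbhd; split.
- by move=> E; apply: ne; rewrite E.
- by rewrite -fe.
- move=> C CA nAC /(nbhd_sub_aut _ _ _ fe) h; apply/(nbhd_sub_aut _ _ _ fe).
  by apply: mx => //; [move/perm_inj | rewrite fe].
- by move/perm_inj.
- by rewrite fe.
- move=> C; rewrite -(permKV f C) => CA nAC /(nbhd_sub_aut _ _ _ fe) h.
  apply/(nbhd_sub_aut _ _ _ fe); apply: mx => //; last by rewrite -fe.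
  by move=> E; apply: CA; rewrite E.
Qed.

(** * An automorphism invariant: rigid exchanges *)

(* For exchange-adjacent [A] and [B] this says that their union is stable. *)
Definition extendable (A B : V) : Prop :=
  exists C : V, [/\ C <> A, C <> B & nbhd_sub KG A B C].

Lemma extendable_aut (f : {perm V}) : graph_automorphism KG f ->
  forall A B, extendable A B -> extendable (f A) (f B).
Proof.
move=> fe A B [C [CA CB h]]; exists (f C); split; try by move/perm_inj.
exact/nbhd_sub_aut.
Qed.

(* Some exchange at [A] forms no induced 4-cycle of the exchange graph with a
   non-extendable exchange at [A]. *)
Definition rigid_exchange (A : V) : Prop := exists2 B, exchange_adj A B &
  forall C D, exchange_adj A C -> ~ extendable A C -> ~~ exchange_adj B C -> B <> C ->
    exchange_adj B D -> exchange_adj C D -> ~~ exchange_adj A D -> D = A.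

Lemma rigid_exchange_aut (f : {perm V}) : graph_automorphism KG f ->
  forall A, rigid_exchange A -> rigid_exchange (f A).
Proof.
move=> fe A [B AB h]; have fJ := exchange_adj_aut fe.
exists (f B) => [|C D]; first by rewrite fJ.
rewrite -(permKV f C) -(permKV f D) !fJ => AC nT nBC BC BD CD AD.
congr (f _); apply: h AC _ nBC _ BD CD AD.
  by move=> h; apply: nT; apply: extendable_aut.
by move=> E; apply: BC; rewrite E.
Qed.

Lemma card_vertexD1 (A : V) c : c \in val A -> #|val A :\ c| = k.-1.
Proof.
by move=> Ac; have := cardsD1 c (val A); rewrite Ac card_vertex => /(congr1 predn) ->.
Qed.

Lemma exchange_adj_common (A B : V) (S : {set 'I_n}) : A <> B ->
  S \subset val A -> S \subset val B -> k.-1 <= #|S| -> exchange_adj A B.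
Proof.
move=> /eqP ne SA SB cS; rewrite /exchange_adj ne /=.
have := subset_leq_card (subsetIl (val A) (val B)); rewrite card_vertex => le.
have ge : #|S| <= #|val A :&: val B| by apply: subset_leq_card; rewrite subsetI SA.
have /eqP nk : #|val A :&: val B| != k.
  apply: contra ne => /eqP cI; apply/eqP; apply: sub_vertex_eq; apply/setIidPl/eqP.
  by rewrite eqEcard subsetIl cI card_vertex /=.
move: le nk (leq_trans cS ge) k1; move: #|_ :&: _| => m; clear; lia.
Qed.

(** A neighbour of [B] without [x] was obtained by removing [x], so it still contains [A - a]. Hence
    in an induced 4-cycle the corner opposite to [A] must contain the new points of both neighbours
    of [A]. *)
Lemma exchange_adj_back (A B D : V) a x : a \in val A -> x \notin val A ->
  val B = x |: (val A :\ a) -> exchange_adj B D -> x \notin val D ->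
  D <> A -> exchange_adj A D.
Proof.
move=> Aa Ax EB /exchange_adjP[w [z [Bw Bz ED]]] Dx DA.
have wx : w = x.
  apply/eqP; apply: contraNT Dx => wx.
  by rewrite ED EB !inE eqxx (eq_sym x w) wx orbT.
apply: (@exchange_adj_common _ _ (val A :\ a)); rewrite ?subD1set //.
- by move=> E; apply: DA.
- rewrite ED wx EB setU1K ?subsetUr // !inE negb_and (negPf Ax) orbT //.
- by rewrite card_vertexD1.
Qed.

(** All of [A + y] is stable here, and [k >= 2] leaves a second point [b'] to replace by [y], which
    gives a third vertex inside the union. *)
Lemma extendable_far (A C : V) b y : b \in val A -> y \notin val A ->
  val C = y |: (val A :\ b) -> {in val A, forall z : 'I_n, far n s y z} ->
  extendable A C.
Proof.
move=> Ab Ay EC hy.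
have [b' Ab' bb'] : exists2 b', b' \in val A & b' != b.
  have : 0 < #|val A :\ b| by rewrite card_vertexD1 //; move: k1; clear; lia.
  by case/card_gt0P=> b' /setD1P[]; exists b'.
have DK : y |: (val A :\ b') \in stable_ksets n k s.
  by apply: swap_stable_ksets => //; [exact: valP | move=> z Az _; exact: hy].
exists (Sub (y |: (val A :\ b')) DK); split.
- by move/(congr1 val) => /= E; move: Ay; rewrite /= -E setU11.
- move/(congr1 val) => /= /setP/(_ b'); rewrite EC !inE eqxx bb' Ab' orbT orbF.
  by move/eqP => E; rewrite -E Ab' in Ay.
apply/exchange_nbhd_sub => //=; first by apply/exchange_adjP; exists b, y.
rewrite EC; apply/subsetP => z; rewrite !inE => /orP[->|/andP[_ ->]] //.
by rewrite orbT.
Qed.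

(** A vertex inside [A + y] is [A] if it misses [y] and [C] if it misses [b]; a third one would
    contain both, and they are too close. *)
Lemma not_extendable_near (A C : V) b y : b \in val A -> y \notin val A ->
  val C = y |: (val A :\ b) -> ~~ far n s b y -> ~ extendable A C.
Proof.
move=> Ab Ay EC nby [D [DA DC]].
have AC : exchange_adj A C by apply/exchange_adjP; exists b, y.
move/(exchange_nbhd_sub _ AC) => /subsetP sD.
have sD' z : z \in val D -> z = y \/ z \in val A.
  move/sD; rewrite EC !inE => /orP[|/orP[/eqP|/andP[]]]; by auto.
have Dy : y \in val D.
  apply/negPn/negP => Dy; apply: DA; apply: sub_vertex_eq; apply/subsetP => z Dz.
  by case: (sD' z Dz) => // E; rewrite E (negPf Dy) in Dz.
have Db : b \in val D.
  apply/negPn/negP => Db; apply: DC; apply: sub_vertex_eq; apply/subsetP => z Dz.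
  rewrite EC !inE; case: (sD' z Dz) => [->|->]; first by rewrite eqxx.
  by rewrite (contraNneq _ Db) ?orbT // => <-.
case/negP: nby; apply: (vertex_far Db Dy) => /val_inj E.
by rewrite -E Ab in Ay.
Qed.

(* [A - b + y] and [A - a - b + x + y] close an induced 4-cycle on [A] and
   [A - a + x]. *)
Lemma not_rigid_exchange (A : V) :
  (forall a x, a \in val A -> x \notin val A -> x |: (val A :\ a) \in stable_ksets n k s ->
   exists b y : 'I_n, [/\ b \in val A, y \notin val A & b != a] /\
    [/\ y != x, {in val A, forall z : 'I_n, z != b -> far n s y z},
        far n s y x & ~~ far n s b y]) ->
  ~ rigid_exchange A.
Proof.
move=> H [B /exchange_adjP[a [x [Aa Ax EB]]] h].
have BK : x |: (val A :\ a) \in stable_ksets n k s by rewrite -EB (valP B).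
have [b [y [[Ab Ay ba] [yx hy yfx nby]]]] := H a x Aa Ax BK.
have CK : y |: (val A :\ b) \in stable_ksets n k s.
  by apply: swap_stable_ksets => //; exact: valP.
have Bb : b \in val B by rewrite EB !inE ba Ab orbT.
have By : y \notin val B by rewrite EB !inE (negPf yx) (negPf Ay) andbF.
have DK : y |: (val B :\ b) \in stable_ksets n k s.
  apply: swap_stable_ksets => // [|z]; first exact: valP.
  by rewrite EB => /setU1P[-> //|/setD1P[_ Az] zb]; apply: hy.
have [C EC] : exists C : V, val C = y |: (val A :\ b) by exists (Sub (y |: (val A :\ b)) CK).
have [D ED] : exists D : V, val D = y |: (val B :\ b) by exists (Sub (y |: (val B :\ b)) DK).
have xb : x != b by apply: contraNneq Ax => ->.
have cS : #|val A :\ a :\ b| = k.-2.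
  have := cardsD1 a (val A); have := cardsD1 b (val A :\ a).
  by rewrite Aa card_vertex in_setD1 ba Ab => -> /(congr1 (fun m => m.-2)) ->.
have AC : exchange_adj A C by apply/exchange_adjP; exists b, y.
have nT : ~ extendable A C by apply: (not_extendable_near Ab Ay).
have small (X Y : V) : val X :&: val Y \subset val A :\ a :\ b -> ~~ exchange_adj X Y.
  move=> /subset_leq_card; rewrite cS => le; rewrite /exchange_adj negb_and.
  by apply/orP; right; rewrite neq_ltn; move: le k1; clear; lia.
have nBC : ~~ exchange_adj B C.
  apply: small; apply/subsetP => z; rewrite EB EC !inE.
  case: (eqVneq z x) => [->|_] /=; first by rewrite (negPf Ax) eq_sym (negPf yx) andbF.
  case: (eqVneq z y) => [->|_] /=; first by rewrite (negPf Ay) !andbF.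
  by case/andP => /andP[-> ->] /andP[-> _].
have BC : B <> C.
  move=> /(congr1 val); rewrite EB EC => /setP/(_ x); rewrite !inE eqxx (negPf Ax) !andbF.
  by rewrite (eq_sym x y) (negPf yx).
have BD : exchange_adj B D by apply/exchange_adjP; exists b, y.
have CD : exchange_adj C D.
  apply/exchange_adjP; exists a, x; split.
  - by rewrite EC !inE Aa (eq_sym a b) ba orbT.
  - by rewrite EC !inE negb_or (eq_sym x y) yx (negPf Ax) andbF.
  - apply/setP => z; rewrite EC ED EB !inE.
    case: (eqVneq z y) => [->|zy] /=.
      have -> : y != a by apply: contraNneq Ay => ->.
      by rewrite orbT.
    case: (eqVneq z x) => [->|_] /=; first by rewrite xb.
    by rewrite andbCA.
have nAD : ~~ exchange_adj A D.
  apply: small; apply/subsetP => z; rewrite ED EB !inE.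
  case: (eqVneq z y) => [->|_] /=; first by rewrite (negPf Ay).
  case: (eqVneq z x) => [->|_] /=; first by rewrite (negPf Ax).
  by case/andP => -> /andP[-> /andP[-> _]].
by case/negP: Ay; rewrite -(h C D AC nT nBC BC BD CD nAD) ED setU11.
Qed.

(** * Two vertices told apart by rigidity *)

Definition progression : {set 'I_n} := [set i : 'I_n | (s %| i) && (i < s * k)].

Lemma card_progression : s * k <= n -> #|progression| = k.
Proof.
move=> skn; have lt (j : 'I_k) : j * s < n.
  by apply: leq_trans skn; rewrite mulnC ltn_pmul2l //; lia.
suff -> : progression = [set Ordinal (lt j) | j : 'I_k].
  rewrite card_imset ?card_ord // => i j /(congr1 val) /= /eqP.
  by rewrite eqn_pmul2r; [move/eqP/val_inj | lia].
apply/setP => i; rewrite inE; apply/andP/imsetP => [[/dvdnP[u iu] lti]|[j _ ->]].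
  have uk : u < k by move: lti; rewrite iu mulnC ltn_pmul2l //; lia.
  by exists (Ordinal uk) => //; apply: val_inj.
by rewrite /= dvdn_mull //; split => //; rewrite (mulnC s) ltn_pmul2r ?ltn_ord //; lia.
Qed.

Lemma progression_stable : s * k <= n -> progression \in stable_ksets n k s.
Proof.
move=> skn; apply/stable_ksetsP; split; first exact: card_progression.
have H (u v : nat) : u < v -> v * s < s * k -> far n s (u * s) (v * s).
  move=> uv vk; have vk' : v < k by move: vk; rewrite mulnC ltn_pmul2l //; lia.
  have h1 : u.+1 * s <= v * s by rewrite leq_mul2r uv orbT.
  have h2 : v.+1 * s <= k * s by rewrite leq_mul2r vk' orbT.
  by rewrite /far; move: h1 h2; rewrite !mulSn (mulnC k); lia.
have farC i j : far n s i j = far n s j i by rewrite /far orbC.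
move=> i j; rewrite !inE -val_eqE /= => /andP[/dvdnP[u ->] uk] /andP[/dvdnP[v ->] vk] ne.
case: (ltngtP u v) => [uv|vu|E]; [exact: H | by rewrite farC H | by rewrite E eqxx in ne].
Qed.

Lemma progression_block (y : 'I_n) : y < s * k -> exists2 z : 'I_n,
  z \in progression & z <= y < z + s.
Proof.
move=> yk; have ly := ltn_ord y; have := leq_trunc_div y s => h.
have ln : y %/ s * s < n by lia.
exists (Ordinal ln); first by rewrite inE /= dvdn_mull //=; lia.
by rewrite /= h /= {1}(divn_eq y s) ltn_add2l ltn_pmod //; lia.
Qed.

Lemma rigid_progression (A : V) : s * k < n -> val A = progression -> rigid_exchange A.
Proof.
move=> skn EA; have skk : s * k = s * k.-1 + s by rewrite -mulnSr prednK //; lia.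
have la : s * k.-1 < n by lia.
have lx : n - s < n by lia.
have [a aE] : exists a : 'I_n, a = s * k.-1 :> nat by exists (Ordinal la).
(* [n - s] is the last position still far from [0]; every later one is near both [0] and [x]. *)
have [x xE] : exists x : 'I_n, x = n - s :> nat by exists (Ordinal lx).
have AP (y : 'I_n) : y \in val A -> (y = a \/ y + s <= s * k.-1).
  rewrite EA inE => /andP[/dvdnP[u yu]]; rewrite yu mulnC ltn_pmul2l => [uk|]; last by lia.
  case: (ltnP u k.-1) => h; last by left; apply: val_inj; rewrite /= yu aE; move: uk h; clear; nia.
  by right; move: h; clear; nia.
have Aa : a \in val A by rewrite EA inE aE dvdn_mulr //=; lia.
have Ax : x \notin val A.
  apply/negP => /AP[/(congr1 val) /= E|]; last by lia.
  by move: E; rewrite xE aE; lia.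
have BK : x |: (val A :\ a) \in stable_ksets n k s.
  apply: swap_stable_ksets => // [|y /AP[-> | h _]]; first exact: valP.
    by rewrite eqxx.
  by rewrite /far xE; lia.
have [B EB] : exists B : V, val B = x |: (val A :\ a) by exists (Sub (x |: (val A :\ a)) BK).
exists B; first by apply/exchange_adjP; exists a, x.
move=> C D /exchange_adjP[b [y [Ab Ay EC]]] nT nBC BC BD CD nAD.
apply/eqP; apply: contraNT nAD => /eqP DA.
(* With [D <> A], both [x] and [y] must lie in [D], for otherwise [D] would be adjacent to [A]. *)
have [Dx|] := boolP (x \in val D); last first.
  by move=> Dx; apply: (exchange_adj_back Aa Ax EB).
have [Dy|] := boolP (y \in val D); last first.
  by move=> Dy; apply: (exchange_adj_back Ab Ay EC).
exfalso.
have ba : b != a.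
  apply: contraNneq nBC => E; apply: (@exchange_adj_common _ _ (val A :\ a)) => //.
  - by rewrite EB subsetUr.
  - by rewrite EC E subsetUr.
  - by rewrite card_vertexD1.
have yx : y <> x.
  move=> E; case/negP: nBC; apply: (@exchange_adj_common _ _ (x |: (val A :\ a :\ b))) => //.
  - by rewrite EB setUS // subD1set.
  - by rewrite EC E setUS // setSD // subD1set.
  - rewrite cardsU1 !inE (negPf Ax) !andbF /=.
    by have := cardsD1 b (val A :\ a); rewrite card_vertexD1 // !inE ba Ab => ->.
have Cy : y \in val C by rewrite EC setU11.
have inC z : z \in val A -> z != b -> z \in val C by move=> Az zb; rewrite EC !inE zb Az orbT.
have yz z : z \in val A -> z != b -> far n s y z.
  move=> Az zb; apply: (vertex_far Cy (inC z Az zb)) => /val_inj E.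
  by rewrite E Az in Ay.
have ly := ltn_ord y.
(* A point [y] below [s * k] lies in the block of some [z] in [A], so [z] has to be the removed
   point [b]. As [b] is not the last term, [z + s] remains in the set and is also near [y]. *)
have ya : s * k <= y.
  rewrite leqNgt; apply/negP => /progression_block[z]; rewrite -EA => Az hz.
  have nyz : y <> z :> nat by move/val_inj => E; rewrite E Az in Ay.
  have zb : z = b.
    apply/eqP/negPn/negP => /(yz z Az); rewrite /far.
    by move: hz nyz; clear; lia.
  have zle : z + s <= s * k.-1 by case: (AP z Az) => // E; rewrite zb in E; rewrite E eqxx in ba.
  have lz : z + s < n by move: zle la; clear; lia.
  have Az' : Ordinal lz \in val A.
    move: Az; rewrite EA !inE /= => /andP[sz _]; rewrite dvdn_addl // sz /=.
    by move: zle skk s1; clear; lia.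
  have zb' : Ordinal lz != b by rewrite -zb -val_eqE /=; move: s1; clear; lia.
  by have := yz _ Az' zb'; rewrite /far /=; move: hz nyz; clear; lia.
(* Between [s * k] and [n - s] the point [y] would be far from all of [A], making the exchange
   extendable. Beyond [n - s] it is too close to [x] for [D] to contain both. *)
have yn : n - s < y.
  rewrite ltnNge; apply/negP => yn; apply: nT; apply: (extendable_far Ab Ay EC) => z.
  by case/AP => [->|h]; rewrite /far ?aE; [|move: h];
    move: ya yn skk skn; move: (s * k) (s * k.-1); clear; lia.
have := vertex_far Dy Dx; rewrite /far xE => h.
have : y <> n - s :> nat by move: yn; clear; lia.
by move/h; move: ly yn; clear; lia.
Qed.

(** The witness is [0, s, ..., q, q + s + 1] with [q = s * k.-2]. As [n >= s * k + 2], its last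
    point [p] can slide one step either way. Each exchange is answered by sliding another point of
    the set one step to a place far from [x]; since [s > 1], the old and new positions are near, as
    [not_rigid_exchange] requires. *)
Lemma exists_not_rigid : s * k + 2 <= n -> exists A : V, ~ rigid_exchange A.
Proof.
move=> skn.
have [q qE] : exists q, q = s * k.-2 by exists (s * k.-2).
have qE1 : s * k.-1 = q + s.
  by rewrite qE -mulnSr; congr (_ * _); move: k1; clear; lia.
have skk : s * k = q + s + s.
  by rewrite -qE1 -mulnSr; congr (_ * _); move: k1; clear; lia.
have sq : s %| q by rewrite qE dvdn_mulr.
have qn : q + s + s + 2 <= n by rewrite -skk.
have PK : progression \in stable_ksets n k s by apply: progression_stable; lia.
have ex m : m < n -> exists i : 'I_n, i = m :> nat by move=> h; exists (Ordinal h).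
have [iz izE] : exists i : 'I_n, i = 0 :> nat by apply: ex; lia.
have [iq iqE] : exists i : 'I_n, i = q :> nat by apply: ex; lia.
have [iq1 iq1E] : exists i : 'I_n, i = q + 1 :> nat by apply: ex; lia.
have [r rE] : exists i : 'I_n, i = q + s :> nat by apply: ex; lia.
have [p pE] : exists i : 'I_n, i = q + s + 1 :> nat by apply: ex; lia.
have [p1 p1E] : exists i : 'I_n, i = q + s + 2 :> nat by apply: ex; lia.
have [l lE] : exists i : 'I_n, i = n - 1 :> nat by apply: ex; lia.
have PP (z : 'I_n) : z \in progression -> z <> r ->
    [/\ z <= q, z = 0 :> nat \/ s <= z & z = q :> nat \/ z + s <= q].
  rewrite inE => /andP[/dvdnP[u zu]]; rewrite zu mulnC ltn_pmul2l => [uk ne|]; last by lia.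
  have uq : u <= k.-2.
    suff : u <> k.-1 by move: uk; clear; lia.
    by move=> E; apply: ne; apply: val_inj; rewrite /= zu rE E mulnC.
  split; first by rewrite qE leq_mul2l uq orbT.
    by case: (u) => [|v]; [left; rewrite muln0 | right; rewrite mulnS leq_addr].
  case: (ltngtP u k.-2) => [h|h|->]; [right | by move: uq h; clear; lia | by left].
  by rewrite -mulnSr qE leq_mul2l h orbT.
have rP : r \in progression.
  by rewrite inE rE dvdn_add //=; move: skk s1; clear; lia.
have pP : p \notin progression.
  rewrite inE pE negb_and; apply/orP; left.
  by rewrite dvdn_addr ?dvdn_add // dvdn1; move: s1; clear; lia.
have AK : p |: (progression :\ r) \in stable_ksets n k s.
  apply: swap_stable_ksets => // z /PP h /eqP /h [zq _ _]; rewrite /far pE.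
  by move: zq qn; clear; lia.
have [A EA] : exists A : V, val A = p |: (progression :\ r).
  by exists (Sub (p |: (progression :\ r)) AK).
have AP (z : 'I_n) : z \in val A -> z = p \/
    [/\ z <= q, z = 0 :> nat \/ s <= z & z = q :> nat \/ z + s <= q].
  rewrite EA => /setU1P[->|/setD1P[/eqP ne zP]]; [by left | right; exact: PP].
have inA (z : 'I_n) : s %| z -> z <= q -> z \in val A.
  move=> sz zq; rewrite EA !inE sz -!val_eqE /= rE pE.
  by move: zq skk s1; clear; lia.
clear PP rP pP AK PK ex.
exists A; apply: not_rigid_exchange => a x Aa Ax /stable_ksetsP[_ BK].
have xfar (z : 'I_n) : z \in val A -> z != a -> far n s x z.
  move=> Az za; apply: BK; [exact: setU11 | by apply/setU1P; right; apply/setD1P |].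
  by apply: contraNneq Ax => ->.
clear BK.
have Ap : p \in val A by rewrite EA setU11.
have nA (z : 'I_n) : q < z -> z <> p :> nat -> z \notin val A.
  move=> h1 h2; apply/negP => /AP[E|[h3 _ _]]; first by rewrite E in h2.
  by move: h1 h3; clear; lia.
have ltx := ltn_ord x.
have xp : x <> p :> nat by move/val_inj => E; rewrite E Ap in Ax.
have Az : iz \in val A by apply: inA; rewrite izE.
case: (eqVneq a p) => [ap|ap].
  have za : iz != a by rewrite ap -val_eqE /= izE pE; clear; lia.
  have := xfar iz Az za; rewrite /far izE => xz.
  (* Below [q + s] every block starts at a remaining point of [A], so [x] cannot fall there. *)
  have xr : q + s <= x.
    rewrite leqNgt; apply/negP => hx.
    have lb : x < s * k by rewrite skk; lia.
    have [z] := progression_block lb; rewrite inE => /andP[sz _] hz.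
    have zq : z <= q.
      case/dvdnP: sz hz => u ->; rewrite -qE1 in hx => /andP[hz _].
      have : s * u < s * k.-1 by apply: leq_ltn_trans hx; rewrite mulnC.
      rewrite ltn_pmul2l; last by move: s1; clear; lia.
      by move=> uk; rewrite qE mulnC leq_mul2l; apply/orP; right; move: uk; clear; lia.
    have zna : z != a by rewrite ap -val_eqE /= pE; move: zq; clear; lia.
    have := xfar z (inA z sz zq) zna.
    have : x <> z :> nat by move/val_inj => E; move: Ax; rewrite E inA.
    by rewrite /far; move: hz ltx (ltn_ord z) qn s1; clear; lia.
  (* If [x = q + s], the point [0] slides back to [n - 1], still far from [p] because of the slack
     of two. Otherwise [x] is at least [q + s + 2], and [q] slides to [q + 1]. *)
  case: (eqVneq (x : nat) (q + s)) => [Ex|/eqP Ex].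
    exists iz, l; split; split => //.
    + by apply: nA; rewrite ?pE lE; move: qn s1; clear; lia.
    + by rewrite -val_eqE /= lE Ex; move: qn s1; clear; lia.
    + move=> z /AP[-> _|[h1 h2 _] h3].
        by rewrite /far pE lE; move: qn; clear; lia.
      have : z <> 0 :> nat by rewrite -izE => /val_inj E; rewrite E eqxx in h3.
      by rewrite /far lE; move: h1 h2 qn s1; clear; lia.
    + by rewrite /far lE Ex; move: qn s1; clear; lia.
    + by rewrite /far lE izE; move: s1; clear; lia.
  rewrite pE in xp; exists iq, iq1; split; split.
  + by apply: inA; rewrite iqE.
  + by apply: nA; rewrite iq1E ?pE; move: s1; clear; lia.
  + by rewrite ap -val_eqE /= iqE pE; clear; lia.
  + by rewrite -val_eqE /= iq1E; move: xr s1; clear; lia.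
  + move=> z /AP[-> _|[h1 _ h2] h3].
      by rewrite /far pE iq1E; move: qn; clear; lia.
    have : z <> q :> nat by rewrite -iqE => /val_inj E; rewrite E eqxx in h3.
    by rewrite /far iq1E; move: h1 h2 qn; clear; lia.
  + by rewrite /far iq1E; move: xz xr Ex xp s1 qn; clear; lia.
  + by rewrite /far iq1E iqE; move: s1 qn; clear; lia.
(* Now [p] stays in place, and it slides away from [x]: to [p1] if [x] is below it, to [r] if
   above. *)
have := xfar p Ap; rewrite eq_sym ap /far pE => /(_ isT) fxp.
case: (ltnP x p) => [|]; rewrite pE => hx.
  exists p, p1; split; split => //.
  + by apply: nA; rewrite p1E ?pE; clear; lia.
  + by rewrite eq_sym.
  + by rewrite -val_eqE /= p1E; move: hx; clear; lia.
  + move=> z /AP[->|[h1 _ _] _]; first by rewrite eqxx.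
    by rewrite /far p1E; move: h1 qn; clear; lia.
  + by rewrite /far p1E; move: fxp hx qn; clear; lia.
  + by rewrite /far p1E pE; move: s1 qn; clear; lia.
exists p, r; split; split => //.
+ by apply: nA; rewrite rE ?pE; move: s1; clear; lia.
+ by rewrite eq_sym.
+ by rewrite -val_eqE /= rE; move: hx; clear; lia.
+ move=> z /AP[->|[h1 _ _] _]; first by rewrite eqxx.
  by rewrite /far rE; move: h1 qn; clear; lia.
+ by rewrite /far rE; move: fxp hx ltx qn; clear; lia.
+ by rewrite /far rE pE; move: s1 qn; clear; lia.
Qed.

(** * Transitivity by rotations when [n = s * k + 1] *)

Lemma rot_automorphism t : t <= n -> exists2 f : {perm V},
  graph_automorphism KG f & forall A, val (f A) = @rot_ord n t @: val A.
Proof.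
move=> tn.
have K (A : V) : @rot_ord n t @: val A \in stable_ksets n k s.
  apply: imset_stable_ksets; [by move: s1; clear; lia | exact: valP |].
  move=> i j Ai Aj ij; rewrite far_rot_ord // (vertex_far Ai Aj) //.
  by move/val_inj => E; rewrite E eqxx in ij.
pose g (A : V) : V := Sub (@rot_ord n t @: val A) (K A).
have g_inj : injective g.
  move=> A B /(congr1 val) /= E; apply: val_inj.
  by apply: (imset_inj (rot_ord_inj tn)).
exists (perm g_inj) => [A B|A]; rewrite !permE //.
rewrite /stable_Kneser /= imset_disjoint //; exact: rot_ord_inj.
Qed.

(** Pigeonhole: if some [a] in [A] had remainder [r > 0] modulo [s], shifting the points after [a]
    down by [r] and dividing by [s] would map the [k] points injectively to values below [k.-1]. *)
Lemma initial_stable_kset (A : {set 'I_n}) : s * k <= n -> A \in stable_ksets n k s ->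
  {in A, forall i : 'I_n, i <= s * k.-1} -> A = progression.
Proof.
move=> skn /stable_ksetsP[cA sA] ub.
have s0 : 0 < s by lia.
have skk : s * k = s * k.-1 + s by rewrite -mulnSr prednK //; lia.
suff dv (i : 'I_n) : i \in A -> s %| i.
  apply/eqP; rewrite eqEcard card_progression // cA leqnn andbT.
  apply/subsetP => i Ai; rewrite inE dv //=; have := ub i Ai; lia.
move: i => a Aa; rewrite /dvdn -leqn0 leqNgt; apply/negP => r0.
set r := a %% s in r0; have ar : a = a %/ s * s + r :> nat by exact: divn_eq.
have mono (x y : nat) : x + s <= y -> x %/ s < y %/ s.
  move=> xy; have -> : (x %/ s).+1 = (x + s) %/ s by rewrite divnDr // divnn s0 addn1.
  exact: leq_div2r.
have rs : r < s by rewrite ltn_pmod.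
have arE : (a - r) %/ s = a %/ s by rewrite {1}ar addnK mulnK.
pose g (b : 'I_n) := if b <= a then b %/ s else (b - r) %/ s.
have g_lt (b : 'I_n) : b \in A -> g b < k.-1.
  move=> Ab; have := ub b Ab; have := ub a Aa; rewrite /g => h1 h2.
  case: (leqP b a) => ba; last by rewrite ltn_divLR // mulnC; lia.
  apply: leq_ltn_trans (leq_div2r _ ba) _; rewrite -arE ltn_divLR // mulnC.
  by have := leq_mod a s; rewrite -/r; lia.
have g_mono (b c : 'I_n) : b \in A -> c \in A -> b < c -> g b < g c.
  move=> Ab Ac bc; have bc' : b + s <= c.
    have : far n s b c by apply: sA => //; rewrite -val_eqE /=; lia.
    by rewrite /far; lia.
  rewrite /g; case: (leqP c a) => ca.
    by rewrite (leq_trans (ltnW bc) ca); apply: mono.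
  have ac' : a + s <= c.
    have : far n s a c by apply: sA => //; rewrite -val_eqE /=; lia.
    by rewrite /far; lia.
  have := leq_mod a s; rewrite -/r => ra.
  case: (leqP b a) => ba; last by apply: mono; lia.
  by apply: leq_ltn_trans (leq_div2r _ ba) _; rewrite -arE; apply: mono; lia.
(* [inord] needs a successor type; [k.-2.+1] equals [k.-1], and [g_lt] keeps its default value out
   of reach. *)
pose f b : 'I_k.-2.+1 := inord (g b).
have k2 : k.-2.+1 = k.-1 by lia.
have f_inj : {in A &, injective f}.
  move=> b c Ab Ac /(congr1 val); rewrite /= !inordK ?k2 ?g_lt // => gbc.
  apply: val_inj; case: (ltngtP b c) => // h; have := g_mono _ _ _ _ h; rewrite gbc ltnn.
    by move=> /(_ Ab Ac).
  by move=> /(_ Ac Ab).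
have := max_card [pred j | j \in f @: A].
by rewrite card_in_imset // cA card_ord; lia.
Qed.

Lemma rotate_to_progression (A : V) : n = s * k + 1 ->
  exists2 f : {perm V}, graph_automorphism KG f & val (f A) = progression.
Proof.
move=> nsk; have skk : s * k = s * k.-1 + s by rewrite -mulnSr prednK //; lia.
have sn : s <= n by rewrite nsk skk; move: (s * k.-1); clear; lia.
(* [z] is a point preceded by the long gap. Without one, [A] would be closed under stepping back by
   [s]; since [n = s * k + 1], [k] such steps amount to one step forward, and [A] would contain two
   consecutive points. *)
have [z Az Az'] : exists2 z, z \in val A & rot_ord (n - s) z \notin val A.
  have [/existsP[z /andP[]]|/existsPn cl] :=
    boolP [exists z in val A, rot_ord (n - s) z \notin val A]; first by exists z.
  have [z Az] : exists z, z \in val A.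
    by apply/set0Pn; rewrite -card_gt0 card_vertex; move: k1; clear; lia.
  have it m : rot_ord (m * (n - s)) z \in val A.
    elim: m => [|m IH]; first rewrite (_ : rot_ord _ z = z) //.
      by apply: val_inj; rewrite /= addn0 modn_small.
    by have := cl (rot_ord (m * (n - s)) z); rewrite IH /= negbK rot_ordD mulSn addnC.
  have E : rot_ord (k * (n - s)) z = rot_ord 1 z.
    apply: val_inj => /=; suff -> : z + k * (n - s) = k.-1 * n + (z + 1) by rewrite modnMDl.
    rewrite mulnBr (mulnC k s) -{1}[k](@prednK k); last by move: k1; clear; lia.
    by rewrite mulSn; move: (k.-1 * n) (s * k) nsk; clear; lia.
  have := it k; rewrite E => Az1.
  have n1 : 1 <= n by move: sn s1; clear; lia.
  exfalso; have := rot_ord_cases z n1; have := vertex_far Az Az1; rewrite /far.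
  have := ltn_ord z; have := ltn_ord (rot_ord 1 z).
  have : s + s <= n by rewrite nsk skk -[k.-1]prednK ?mulnS;
    [move: (s * k.-2)|move: k1]; clear; lia.
  by move: (rot_ord 1 z : nat) s1; clear; lia.
have lz := ltn_ord z.
have zn : n - z <= n by rewrite leq_subr.
have [f fe fE] := rot_automorphism zn.
exists f => //; apply: initial_stable_kset.
- by rewrite nsk leq_addr.
- exact: valP.
(* With [z] rotated to [0], stability bounds the other points by [n - s], and the choice of [z]
   excludes [n - s] itself; this leaves at most [n - s - 1 = s * k.-1]. *)
move=> _ /[!fE] /imsetP[y Ay ->].
have ly := ltn_ord y; have lr := ltn_ord (rot_ord (n - z) y).
have := rot_ord_cases y zn.
case: (eqVneq y z) => [E|/eqP yz].
  by rewrite E; rewrite E in lr; move: lr lz; move: (rot_ord _ z : nat) (s * k.-1); clear; lia.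
have yz' : y <> z :> nat by move/val_inj.
have := vertex_far Ay Az yz'; rewrite /far => fyz.
have zs : n - s <= n by rewrite leq_subr.
have : y <> rot_ord (n - s) z :> nat.
  by move=> /val_inj E; rewrite -E Ay in Az'.
have := rot_ord_cases z zs; have := ltn_ord (rot_ord (n - s) z).
have nE : n = s * k.-1 + s + 1 by rewrite -skk.
move: fyz lr lz ly sn nE.
move: (rot_ord _ z : nat) (rot_ord _ y : nat) (s * k.-1); clear; lia.
Qed.

Lemma vertex_transitive_stable_Kneser : n = s * k + 1 -> vertex_transitive KG.
Proof.
move=> nsk A B.
have [f fe fA] := rotate_to_progression A nsk.
have [g ge gB] := rotate_to_progression B nsk.
have fg : f A = g B by apply: val_inj; rewrite fA gB.
exists (f * g^-1)%g; last by rewrite permM fg permK.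
by move=> X Y; rewrite !permM -ge !permKV fe.
Qed.

End ExchangeGraph.

Theorem theorem6 (n k s : nat) (hn : 2 <= n) (hk : 2 <= k) (hs : 2 <= s)
    (hnsk : s * k + 1 <= n) :
  vertex_transitive (@stable_Kneser n k s) <-> n = s * k + 1.
Proof.
split=> [tr|]; last exact: vertex_transitive_stable_Kneser.
apply/eqP; rewrite eqn_leq hnsk andbT leqNgt; apply/negP => lt.
have skn2 : s * k + 2 <= n by rewrite addn2 -addn1.
have [B nB] := exists_not_rigid hs hk skn2.
have PK : progression n k s \in stable_ksets n k s.
  by apply: progression_stable => //; move: hnsk; clear; lia.
have [f fe fB] := tr (Sub (progression n k s) PK) B.
apply: nB; rewrite -fB; apply: rigid_exchange_aut => //.
by apply: rigid_progression => //; move: hnsk; clear; lia.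
Qed.
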